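(* Let $g$ be a positive integer, and let $\mathcal{A}=\{a_1<a_2<\cdots\}$, with $0\le a_1$, be an infinite $g$-Golomb ruler (elements listed in increasing order). Then $$\limsup_{n\to\infty} \frac{a_n}{n^2\log n} \ge \frac{\log 2}{2g}.$$
   Context: For a positive integer $g$, a set $\mathcal{A}$ of nonnegative integers is a $g$-Golomb ruler if for each integer $d>0$ there are at most $g$ pairs $(a,b)\in\mathcal{A}\times\mathcal{A}$ with $d=a-b$. Here $\log$ is the natural logarithm, and the limsup is taken in the extended reals (it may be $+\infty$). *)

(* Defs.v *)
From mathcomp Require Import all_boot all_order all_algebra.
From mathcomp Require Import all_classical all_reals all_analysis.
Import Order.TTheory GRing.Theory Num.Theory.

Set Implicit Arguments.
Unset Strict Implicit.
Unset Printing Implicit Defensive.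

Local Open Scope classical_set_scope.
Local Open Scope ring_scope.

(* The difference is taken in [int]: subtraction on [nat] is truncated. *)
Definition golomb_ruler (g : nat) (A : set nat) : Prop :=
  forall d : int, 0 < d ->
    ([set p : nat * nat | [/\ A p.1, A p.2 & d = p.1%:Z - p.2%:Z]] #<= `I_g)%card.

(* The elements are numbered from 1; the value [a 0%N] is irrelevant. *)
Definition increasing_enumeration (A : set nat) (a : nat -> nat) : Prop :=
  (forall i j : nat, (0 < i)%N -> (i < j)%N -> (a i < a j)%N) /\
  [set a n | n in [set n | (0 < n)%N]] = A.

(* Main.v *)
Require Import Defs.
From mathcomp Require Import all_boot all_order all_algebra.
From mathcomp Require Import all_classical all_reals all_analysis.
From mathcomp Require Import zify ring lra.
Import Order.TTheory GRing.Theory Num.Theory.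

Local Open Scope classical_set_scope.
Local Open Scope ring_scope.

(** The proof is a weighted form of the sliding-window argument of Erdos for
    Sidon sets.

    Slide a window of length [H] over a finite part [b] of the ruler, and let
    [D s] be the number of elements [x] of [b] with [x <= s < x + H].  Expanding
    the square, two elements at distance [d < H] lie together in at most
    [H - d] windows, and each [d > 0] occurs at most [g] times, so the sum of
    the [D s ^ 2] is at most [#|b| * H + g * H ^ 2]
    ([window_second_moment]).  With [2 * w * D <= D ^ 2 + w ^ 2], this bounds
    the sum over the ruler of any nonincreasing weight [w]
    ([weighted_window_inequality]).

    Suppose now that [a_n <= c * n ^ 2 * ln n] for all large [n].  The density
    of the extremal sequence suggests the weight
    [w t = H / sqrt (2 * c * t * ln t)].  Then [w (a_i)] is at least about
    [H / (2 * c * i * ln i)], while [w t ^ 2 = H ^ 2 / (2 * c * t * ln t)].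
    Both resulting sums have the shape of the sum of [1 / (x * ln x)], whose
    primitive is [ln (ln x)].  For indices [i] between [m] and [n] and elements
    up to [Y], dividing by [H ^ 2 / (2 * c)] gives, up to small terms,
    [2 * (ln (ln n) - ln (ln m)) <=
       2 * c * (n / H + g) + (ln (ln Y) - ln (ln H))]
    ([window_log_inequality]).

    Take [m = k ^ (p + 1)], [H = m ^ 2], [n = k ^ (2 p + 1)] and
    [Y = k ^ (4 p + 3)].  Then [n / H = 1 / k], and both differences of iterated
    logarithms tend to [ln 2] as [p] grows.  Letting [k] and then [p] tend to
    infinity yields [2 * ln 2 <= 2 * c * g + ln 2], that is
    [c >= ln 2 / (2 * g)] ([golomb_growth_constant]).  Keeping the exponent of
    [n] below that of [H] is what makes the diagonal term [#|b| * H]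
    negligible. *)

(** * Counting pairs in a window *)

(** The cardinality bound on differences, for an injective finite family of
    elements of the ruler, as a count of pairs of indices. *)
Lemma golomb_card_pairs (g : nat) (A : set nat) (I : finType) (b : I -> nat) :
  golomb_ruler g A -> injective b -> (forall i, A (b i)) ->
  forall d : nat, (0 < d)%N ->
  (#|[set p : I * I | b p.1 + d == b p.2]%SET| <= g)%N.
Proof.
move=> hg injb Ab d d0.
set P := [set p : I * I | _]%SET.
rewrite -card_le_II.
have dz : (0 : int) < d%:Z by rewrite ltz_nat.
apply: card_le_trans (hg _ dz).
pose f (k : nat) : nat * nat :=
  if insub k is Some i then
    let p := @enum_val _ (mem P) i in (b p.2, b p.1)
  else (0, 0)%N.
have injf : {in `I_#|P| &, injective f}.
  move=> k l; rewrite !inE /= /f => kP lP.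
  case: insubP => [i _ <-|]; last by rewrite kP.
  case: insubP => [j _ <-|]; last by rewrite lP.
  case=> /injb e2 /injb e1; congr val; apply: enum_val_inj.
  by move: e1 e2; case: (enum_val i); case: (enum_val j) => /= ? ? ? ? -> ->.
rewrite -(card_le_eql (inj_card_eq injf)); apply: subset_card_le.
move=> _ [k /= kP <-]; rewrite /f; case: insubP => [i _ _|]; last by rewrite kP.
have := enum_valP i; rewrite inE => /eqP /= bE; split => //=.
by rewrite -bE PoszD addrC addKr.
Qed.

Lemma sum_nat_interval (N x y : nat) :
  (\sum_(s < N) ((x <= s < y)%N : nat) = minn N y - x)%N.
Proof.
elim: N => [|N IH]; first by rewrite big_ord0; lia.
rewrite big_ord_recr /= IH; case: (leqP x N); case: (ltnP N y) => /= h1 h2.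
all: lia.
Qed.

(** The sliding windows are indexed by [s], the element [b i] being in the
    window when [b i <= s < b i + H].  The coefficient of [g * H ^ 2] is [1],
    which matters for the final constant: for each [d > 0] the ordered pairs at
    signed distance [d] and [- d] contribute [2 * (H - d)], and the sum of these
    over [0 < d < H] is [H * (H - 1)]. *)
Lemma window_second_moment (g : nat) (I : finType) (b : I -> nat) (H N : nat) :
  injective b ->
  (forall d : nat, (0 < d)%N ->
    (#|[set p : I * I | b p.1 + d == b p.2]%SET| <= g)%N) ->
  (\sum_(s < N) (\sum_(i : I) ((b i <= s < b i + H)%N : nat)) ^ 2
     <= #|I| * H + g * H ^ 2)%N.
Proof.
move=> injb hg.
(* [T x y] is [H - (y - x)] when [x < y < x + H] and [0] otherwise, written as
   a sum over the distance [d] so that pairs can be counted distance by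
   distance. *)
pose T (x y : nat) := (\sum_(d < H) ((0 < d) && (x + d == y)) * (H - d))%N.
have TE x y : (x < y)%N -> (H - (y - x) <= T x y)%N.
  move=> xy; have [yH|] := ltnP (y - x) H; last by lia.
  rewrite /T (bigD1 (Ordinal yH)) //= subn_gt0 xy (subnKC (ltnW xy)) eqxx mul1n leq_addr //.
have sumT : (\sum_(i : I) \sum_(j : I) T (b i) (b j) * 2 <= g * H ^ 2)%N.
  under eq_bigr do rewrite -big_distrl /=.
  rewrite -big_distrl /= /T.
  under eq_bigr do rewrite exchange_big /=.
  rewrite exchange_big /=.
  apply: (@leq_trans ((\sum_(d < H) (0 < d)%N * g * (H - d)) * 2)%N).
    rewrite leq_mul2r /=; apply: leq_sum => d _.
    rewrite pair_big /= -big_distrl /= leq_mul2r; apply/orP; right.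
    have [d0|d0] := posnP d; first by rewrite big1.
    rewrite mul1n; apply: leq_trans (hg _ d0).
    by rewrite -sum1dep_card [leqRHS]big_mkcond /= leq_sum // => p _; case: eqP.
  have -> : (\sum_(d < H) (0 < d) * g * (H - d) = g * \sum_(d < H) (0 < d) * (H - d))%N.
    by rewrite big_distrr /=; apply: eq_bigr => d _; lia.
  rewrite -mulnA leq_mul2l; apply/orP; right.
  elim: {T TE} H => [|h IH]; first by rewrite big_ord0.
  have -> : (\sum_(d < h.+1) (0 < d) * (h.+1 - d) =
             \sum_(d < h) (0 < d) * (h - d) + h)%N.
    rewrite big_ord_recr /=.
    have -> : (\sum_(d < h) (0 < d) * (h.+1 - d) =
               \sum_(d < h) ((0 < d) * (h - d)) + \sum_(d < h) (0 < d))%N.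
      by rewrite -big_split /=; apply: eq_bigr => d _; have := ltn_ord d; lia.
    rewrite -addnA; congr addn; case: h {IH} => [|h]; first by rewrite big_ord0.
    by rewrite big_ord_recl /= sum1_card card_ord; lia.
  by lia.
have ovl x y : (x <= y)%N ->
    (\sum_(s < N) (x <= s < x + H) * (y <= s < y + H) <= H - (y - x))%N.
  move=> xy; apply: (@leq_trans (x + H - y)%N); last lia.
  apply: (@leq_trans (minn N (x + H) - y)%N); last lia.
  rewrite -sum_nat_interval; apply: leq_sum => s _; lia.
have -> : (\sum_(s < N) (\sum_(i : I) ((b i <= s < b i + H)%N : nat)) ^ 2 =
   \sum_(i : I) \sum_(j : I) \sum_(s < N) (b i <= s < b i + H) * (b j <= s < b j + H))%N.
  under [RHS]eq_bigr do rewrite exchange_big /=.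
  rewrite exchange_big /=; apply: eq_bigr => s _.
  by rewrite -mulnn big_distrlr.
apply: (@leq_trans (\sum_(i : I) \sum_(j : I)
   ((i == j) * H + T (b i) (b j) + T (b j) (b i)))%N).
  apply: leq_sum => i _; apply: leq_sum => j _.
  have [bij|bji|bE] := ltngtP (b i) (b j).
  - by apply: leq_trans (ovl _ _ (ltnW bij)) _; have := TE _ _ bij; lia.
  - under eq_bigr do rewrite mulnC.
    by apply: leq_trans (ovl _ _ (ltnW bji)) _; have := TE _ _ bji; lia.
  - have -> : i == j by apply/eqP/injb.
    rewrite -bE; apply: leq_trans (ovl _ _ (leqnn _)) _; lia.
under eq_bigr do rewrite !big_split /=.
rewrite !big_split /= -addnA leq_add //.
  rewrite -[X in (X * H)%N]sum1_card big_distrl /=; apply: leq_sum => i _.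
  rewrite -big_distrl leq_mul2r /=; apply/orP; right.
  by rewrite (bigD1 i) //= eqxx big1 // => j; rewrite eq_sym => /negPf->.
rewrite [X in (_ + X)%N]exchange_big /= addnn -muln2.
move: sumT; under eq_bigr do rewrite -big_distrl /=.
by rewrite -big_distrl.
Qed.

(** The weight of window [s] is [w (s - H)] with truncated subtraction: a window
    containing [b i] has [s - H <= b i], hence weight at least [w (b i)].  The
    windows [s <= H] all get weight [w 0]. *)
Lemma weighted_window_inequality (R : realType) (g : nat) (I : finType)
    (b : I -> nat) (H N : nat) (w : nat -> R) :
  injective b ->
  (forall d : nat, (0 < d)%N ->
    (#|[set p : I * I | b p.1 + d == b p.2]%SET| <= g)%N) ->
  (forall i, (b i + H <= N)%N) ->
  (forall x y, (x <= y)%N -> w y <= w x) ->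
  2 * H%:R * (\sum_(i : I) w (b i)) <=
    #|I|%:R * H%:R + g%:R * H%:R ^+ 2 + \sum_(s < N) w (s - H)%N ^+ 2.
Proof.
move=> injb hg hN wle.
pose D (s : nat) := (\sum_(i : I) ((b i <= s < b i + H)%N : nat))%N.
have mom : \sum_(s < N) (D s)%:R ^+ 2 <= #|I|%:R * H%:R + g%:R * H%:R ^+ 2 :> R.
  have -> : \sum_(s < N) (D s)%:R ^+ 2 = (\sum_(s < N) D s ^ 2)%N%:R :> R.
    by rewrite natr_sum; apply: eq_bigr => s _; rewrite natrX.
  rewrite -natrX -!natrM -natrD ler_nat.
  exact: window_second_moment.
have mass : H%:R * (\sum_(i : I) w (b i)) <= \sum_(s < N) w (s - H)%N * (D s)%:R.
  under [leRHS]eq_bigr do rewrite /D natr_sum mulr_sumr.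
  rewrite exchange_big /= mulr_sumr; apply: ler_sum => i _.
  have -> : H%:R = \sum_(s < N) ((b i <= s < b i + H)%N : nat)%:R :> R.
    rewrite -natr_sum sum_nat_interval; congr (_%:R); have := hN i; lia.
  rewrite mulr_suml; apply: ler_sum => s _.
  case: (boolP (_ <= _ < _)%N) => [/andP[_ lt]|_]; last by rewrite mul0r mulr0.
  by rewrite mul1r mulr1; apply: wle; lia.
have young : \sum_(s < N) (2 * (w (s - H)%N * (D s)%:R)) <=
    \sum_(s < N) ((D s)%:R ^+ 2 + w (s - H)%N ^+ 2).
  apply: ler_sum => s _; have := sqr_ge0 ((D s)%:R - w (s - H)%N); lra.
move: young; rewrite -mulr_sumr big_split /=; lra.
Qed.

(** * Logarithms and sums of [1 / (n ln n)] *)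

Lemma ln_le_subr1 (R : realType) (x : R) : 0 < x -> ln x <= x - 1.
Proof.
by move=> x0; rewrite -[x in ln x](subrKC 1); apply: le_ln1Dx; lra.
Qed.

Lemma ln_nat_gt0 (R : realType) (n : nat) : (1 < n)%N -> 0 < ln (n%:R : R).
Proof. by move=> n1; rewrite ln_gt0 // ltr1n. Qed.

Lemma ler_ln_nat (R : realType) (m n : nat) : (0 < m)%N -> (m <= n)%N ->
  ln (m%:R : R) <= ln n%:R.
Proof.
move=> m0 mn; rewrite ler_ln ?posrE ?ltr0n ?ler_nat //; exact: leq_trans mn.
Qed.

Lemma lnln_succ_le (R : realType) (n : nat) : (1 < n)%N ->
  ln (ln n.+1%:R) - ln (ln n%:R) <= (n%:R * ln n%:R)^-1 :> R.
Proof.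
move=> n1.
have ln0 := @ln_nat_gt0 R _ n1; have lS0 := @ln_nat_gt0 R _ (leqW n1).
have n0 : 0 < n%:R :> R by rewrite ltr0n; lia.
have nS0 : 0 < n.+1%:R :> R by rewrite ltr0n.
rewrite -ln_div ?posrE //.
apply: le_trans (@ln_le_subr1 R _ (divr_gt0 lS0 ln0)) _.
rewrite -[X in _ - X](divff (lt0r_neq0 ln0)) -mulrBl invfM ler_wpM2r ?invr_ge0 ?(ltW ln0) //.
rewrite -ln_div ?posrE //.
apply: le_trans (@ln_le_subr1 R _ (divr_gt0 nS0 n0)) _.
by rewrite -[X in _ - X](divff (lt0r_neq0 n0)) -mulrBl -natr1 addrC addKr mul1r.
Qed.

Lemma lnln_succ_ge (R : realType) (n : nat) : (1 < n)%N ->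
  (n.+1%:R * ln n.+1%:R)^-1 <= ln (ln n.+1%:R) - ln (ln n%:R) :> R.
Proof.
move=> n1.
have ln0 := @ln_nat_gt0 R _ n1; have lS0 := @ln_nat_gt0 R _ (leqW n1).
have n0 : 0 < n%:R :> R by rewrite ltr0n; lia.
have nS0 : 0 < n.+1%:R :> R by rewrite ltr0n.
rewrite -[leRHS]opprB lerNr -ln_div ?posrE //.
apply: le_trans (@ln_le_subr1 R _ (divr_gt0 ln0 lS0)) _.
rewrite -[X in _ - X](divff (lt0r_neq0 lS0)) -mulrBl invfM -mulNr.
rewrite ler_wpM2r ?invr_ge0 ?(ltW lS0) // -ln_div ?posrE //.
apply: le_trans (@ln_le_subr1 R _ (divr_gt0 n0 nS0)) _.
by rewrite -[X in _ - X](divff (lt0r_neq0 nS0)) -mulrBl -natr1 opprD addNKr mulN1r.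
Qed.

Lemma sum_inv_nln_ge (R : realType) (m r : nat) : (1 < m)%N ->
  ln (ln (m + r)%:R) - ln (ln m%:R) <=
    \sum_(i < r) ((m + i)%:R * ln (m + i)%:R)^-1 :> R.
Proof.
move=> m1; elim: r => [|r IH]; first by rewrite addn0 subrr big_ord0.
rewrite big_ord_recr /=.
have := @lnln_succ_le R (m + r) (ltn_addr _ m1); rewrite addnS; lra.
Qed.

(** The sum of the squared weights, up to the factor [H ^ 2 / (2 * c)], with
    [1 / (x * ln x)] frozen at its value at
    [H] for [x <= H].  The first [2 * H + 1] terms are equal to
    [1 / (H * ln H)] and give the term [3 / ln H]; the others telescope. *)
Lemma sum_inv_nln_max_le (R : realType) (H r : nat) : (1 < H)%N ->
  \sum_(s < (H + H).+1 + r)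
     ((maxn (s - H) H)%:R * ln (maxn (s - H) H)%:R)^-1 <=
  3 / ln H%:R + (ln (ln (H + r)%:R) - ln (ln H%:R)) :> R.
Proof.
move=> H1; have lH := @ln_nat_gt0 R _ H1.
have H0 : 1 <= H%:R :> R by rewrite ler1n; lia.
elim: r => [|r IH].
  rewrite !addn0 subrr addr0 (eq_bigr (fun=> (H%:R * ln H%:R)^-1)); last first.
    move=> s _; suff -> : maxn (s - H) H = H by [].
    by have := ltn_ord s; lia.
  have Hl0 : 0 < H%:R * ln H%:R :> R by rewrite mulr_gt0 //; lra.
  rewrite sumr_const card_ord -[X in X <= _]mulr_natl ler_pdivrMr //.
  have -> : 3 / ln H%:R * (H%:R * ln H%:R) = 3 * H%:R :> R.
    by rewrite mulrCA divfK ?lt0r_neq0 // mulrC.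
  by rewrite -natr1 natrD; lra.
rewrite addnS big_ord_recr /=.
have -> : maxn ((H + H).+1 + r - H) H = (H + r).+1 by lia.
have := @lnln_succ_ge R (H + r) (ltn_addr _ H1); rewrite addnS => h.
apply: le_trans (lerD IH h) _.
by rewrite -addrA lerD2l addrC addrA subrK.
Qed.

(** * The window inequality for sequences below [c n^2 ln n] *)

Lemma ln_le_linear (R : realType) (s x : R) : 0 < s -> 0 < x ->
  ln x <= s * x - 1 - ln s.
Proof.
move=> s0 x0; have := @ln_le_subr1 R (s * x) (mulr_gt0 s0 x0).
rewrite lnM ?posrE //; lra.
Qed.

(** If [x <= f := c * n ^ 2 * ln n] then [ln x <= ln f], and
    [ln f = 2 * ln n + ln (c * ln n)] is at most [2 * (1 + eps) * ln n], so
    that [sqrt (2 * c * x * ln x)] is at most [2 * c * (1 + eps) * n * ln n]. *)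
Lemma log_weight_ge (R : realType) (c eps : R) (n x : nat) :
  0 < c -> 0 <= eps -> (1 < n)%N -> (1 < x)%N ->
  x%:R <= c * n%:R ^+ 2 * ln n%:R ->
  ln (c * ln n%:R) <= 2 * eps * ln n%:R ->
  (2 * c * (1 + eps))^-1 * (n%:R * ln n%:R)^-1 <=
    (Num.sqrt (2 * c * (x%:R * ln x%:R)))^-1.
Proof.
move=> c0 e0 n1 x1 xle hln.
have l0 := @ln_nat_gt0 R _ n1; have lx0 := @ln_nat_gt0 R _ x1.
have n0 : 0 < n%:R :> R by rewrite ltr0n; lia.
have x0 : 0 < x%:R :> R by rewrite ltr0n; lia.
have f0 : 0 < c * n%:R ^+ 2 * ln n%:R by rewrite !mulr_gt0 ?exprn_gt0.
have lx : ln x%:R <= 2 * (1 + eps) * ln n%:R.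
  apply: (@le_trans _ _ (ln (c * n%:R ^+ 2 * ln n%:R))).
    by rewrite ler_ln ?posrE.
  have -> : c * n%:R ^+ 2 * ln n%:R = n%:R ^+ 2 * (c * ln n%:R) by ring.
  by rewrite lnM ?posrE ?mulr_gt0 ?exprn_gt0 // lnXn // mulr2n; lra.
rewrite -invfM lef_pV2 ?posrE ?sqrtr_gt0 ?mulr_gt0 //; last by lra.
have y0 : 0 <= 2 * c * (1 + eps) * (n%:R * ln n%:R).
  by rewrite !mulr_ge0 ?ltW //; lra.
rewrite -[leRHS]ger0_norm // -sqrtr_sqr ler_wsqrtr //.
apply: (@le_trans _ _ (2 * c * ((c * n%:R ^+ 2 * ln n%:R) * (2 * (1 + eps) * ln n%:R)))).
  by rewrite ler_wpM2l ?ler_pM ?ler0n ?(ltW lx0) //; lra.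
have -> : (2 * c * (1 + eps) * (n%:R * ln n%:R)) ^+ 2 =
   (1 + eps) * (2 * c * (c * n%:R ^+ 2 * ln n%:R * (2 * (1 + eps) * ln n%:R))) by ring.
rewrite -[leLHS]mul1r ler_wpM2r //; last by lra.
by rewrite !mulr_ge0 ?sqr_ge0 ?ltW //; lra.
Qed.

(** The index [i : 'I_r] stands for the rank [m + i] in the ruler.  The bound
    [c * (m + i) ^ 2 * ln (m + i)] is also required to dominate [H], because the
    weight is frozen below [H]. *)
Lemma window_log_inequality (R : realType) (g m r H t : nat) (c eps : R)
    (b : 'I_r -> nat) :
  0 < c -> 0 <= eps -> (1 < m)%N -> (1 < H)%N -> injective b ->
  (forall d : nat, (0 < d)%N ->
    (#|[set p : 'I_r * 'I_r | (b p.1 + d)%N == b p.2]%SET| <= g)%N) ->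
  (forall i, (b i <= H + t)%N) ->
  (forall i, (maxn (b i) H)%:R <= c * (m + i)%:R ^+ 2 * ln (m + i)%:R) ->
  (forall i : 'I_r, ln (c * ln (m + i)%:R) <= 2 * eps * ln (m + i)%:R) ->
  2 / (1 + eps) * (ln (ln (m + r)%:R) - ln (ln m%:R)) <=
    2 * c * (r%:R / H%:R + g%:R) + 3 / ln H%:R
      + (ln (ln (H + t)%:R) - ln (ln H%:R)).
Proof.
move=> c0 e0 m1 H1 injb hg hY hf hln.
have H0 : 0 < H%:R :> R by rewrite ltr0n; lia.
pose u (x : nat) : R := (Num.sqrt (2 * c * ((maxn x H)%:R * ln (maxn x H)%:R)))^-1.
have max1 x : (1 < maxn x H)%N by lia.
have arg0 x : 0 < (maxn x H)%:R * ln (maxn x H)%:R :> R.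
  by rewrite mulr_gt0 ?ln_nat_gt0 // ltr0n; have := max1 x; lia.
have uE x : u x ^+ 2 = (2 * c)^-1 * ((maxn x H)%:R * ln (maxn x H)%:R)^-1.
  by rewrite /u exprVn sqr_sqrtr ?invfM // mulr_ge0 ?(ltW (arg0 x)) //; lra.
have ule x y : (x <= y)%N -> u y <= u x.
  move=> xy; rewrite lef_pV2 ?posrE ?sqrtr_gt0 ?(mulr_gt0 (mulr_gt0 _ c0)) //.
  have mxy : (maxn x H <= maxn y H)%N by lia.
  rewrite ler_wsqrtr // ler_wpM2l ?ler_pM ?ler0n ?ler_nat ?ler_ln_nat //.
  - lra.
  - exact/ltW/ln_nat_gt0.
  - by have := max1 x; lia.
have hN i : (b i + H <= (H + H).+1 + t)%N by have := hY i; lia.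
have hw (x1 x2 : nat) : (x1 <= x2)%N -> H%:R * u x2 <= H%:R * u x1.
  by move=> x12; rewrite ler_pM2l // ule.
have main := @weighted_window_inequality R g _ b H _ (fun x => H%:R * u x)
  injb hg hN hw.
have uge (i : 'I_r) :
    (2 * c * (1 + eps))^-1 * ((m + i)%:R * ln (m + i)%:R)^-1 <= u (b i).
  by apply: log_weight_ge => //; lia.
have lower : (2 * c * (1 + eps))^-1 * (ln (ln (m + r)%:R) - ln (ln m%:R)) <=
    \sum_(i < r) u (b i).
  apply: (@le_trans _ _ ((2 * c * (1 + eps))^-1 *
     \sum_(i < r) ((m + i)%:R * ln (m + i)%:R)^-1)).
    rewrite ler_wpM2l ?sum_inv_nln_ge // invr_ge0 !mulr_ge0 ?ltW //; lra.
  by rewrite mulr_sumr; apply: ler_sum => i _; exact: uge.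
have upper : \sum_(s < (H + H).+1 + t) u (s - H)%N ^+ 2 <=
    (2 * c)^-1 * (3 / ln H%:R + (ln (ln (H + t)%:R) - ln (ln H%:R))).
  under eq_bigr do rewrite uE.
  rewrite -mulr_sumr ler_wpM2l ?sum_inv_nln_max_le // invr_ge0; lra.
move: main lower upper.
rewrite -mulr_sumr; under [X in _ + X]eq_bigr do rewrite exprMn.
rewrite -mulr_sumr card_ord.
set S := \sum_(i < r) _; set Q := \sum_(s < _) _.
set L := ln (ln (m + r)%:R) - _; set K := 3 / _ + _.
move=> main lower upper.
have main' : 2 * S <= r%:R / H%:R + g%:R + Q.
  have HH : 0 < H%:R ^+ 2 :> R by rewrite exprn_gt0.
  rewrite -(ler_pM2l HH).
  have -> : H%:R ^+ 2 * (2 * S) = 2 * H%:R * (H%:R * S) by ring.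
  apply: le_trans main _; rewrite le_eqVlt; apply/orP; left; apply/eqP.
  by field; exact: lt0r_neq0.
have e1 : 1 + eps != 0 by apply: lt0r_neq0; lra.
have lower' : 2 / (1 + eps) * L <= 2 * c * (2 * S).
  have -> : 2 / (1 + eps) * L = 2 * c * (2 * ((2 * c * (1 + eps))^-1 * L)).
    by field; rewrite e1 lt0r_neq0.
  by rewrite ler_pM2l ?ler_pM2l //; lra.
apply: le_trans lower' _.
apply: (@le_trans _ _ (2 * c * (r%:R / H%:R + g%:R + (2 * c)^-1 * K))).
  by rewrite ler_pM2l; lra.
rewrite mulrDr mulrA divff ?mul1r ?addrA //; apply: lt0r_neq0; lra.
Qed.

(** * The growth constant *)

Lemma ln2_le1 (R : realType) : ln (2 : R) <= 1.
Proof. by have := @ln_le_subr1 R 2; lra. Qed.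

Lemma lnln_pow_sub (R : realType) (k i j : nat) :
  (1 < k)%N -> (0 < i)%N -> (0 < j)%N ->
  ln (ln (k ^ i)%N%:R) - ln (ln (k ^ j)%N%:R) = ln (i%:R / j%:R) :> R.
Proof.
move=> k1 i0 j0; have lk := @ln_nat_gt0 R _ k1.
have k0 : 0 < k%:R :> R by rewrite ltr0n; lia.
have i0' : 0 < i%:R :> R by rewrite ltr0n.
have j0' : 0 < j%:R :> R by rewrite ltr0n.
rewrite !natrX !lnXn // -!(mulr_natr (ln _)) ln_div ?posrE //.
rewrite !lnM ?posrE //; ring.
Qed.

Lemma exists_nat_large_ln (R : realType) (n0 : nat) (B : R) :
  exists k : nat, [/\ (1 < k)%N, (n0 <= k)%N & B <= ln k%:R].
Proof.
have [k hk] : exists k : nat, expR B <= k%:R.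
  by exists (Num.bound (expR B)); apply/ltW; rewrite archi_boundP ?expR_ge0.
exists (maxn 2 (maxn n0 k)); split; [lia..|].
rewrite -[X in X <= _]expRK ler_ln ?posrE ?expR_gt0 ?ltr0n //; last lia.
by apply: le_trans hk _; rewrite ler_nat; lia.
Qed.

(** An eventual bound [a_n <= c * n ^ 2 * ln n] forces [c >= ln 2 / (2 * g)]. *)
Lemma golomb_growth_constant (R : realType) (g : nat) (A : set nat)
    (a : nat -> nat) (c : R) (n0 : nat) :
  golomb_ruler g A ->
  (forall i j : nat, (0 < i)%N -> (i < j)%N -> (a i < a j)%N) ->
  (forall i : nat, (0 < i)%N -> A (a i)) ->
  0 < c ->
  (forall n : nat, (n0 <= n)%N -> (a n)%:R <= c * n%:R ^+ 2 * ln n%:R) ->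
  ln 2 <= 2 * c * g%:R.
Proof.
move=> golA ainc aA c0 aub; rewrite leNgt; apply/negP => gap.
pose eta : R := ln 2 - 2 * c * g%:R.
have eta0 : 0 < eta by rewrite /eta; lra.
(* The exponent [p] controls how far [(2 p + 1) / (p + 1)] is from [2]. *)
have [p hp] : exists p : nat, 2 / (p.*2.+1)%:R <= eta / 8.
  exists (Num.bound (16 / eta)).
  have := @archi_boundP R (16 / eta) (divr_ge0 (ler0n _ _) (ltW eta0)).
  set P := Num.bound _; rewrite ltr_pdivrMr // => hP.
  have -> : P.*2.+1%:R = 2 * P%:R + 1 :> R by rewrite -[LHS]natr1 -mul2n natrM.
  by rewrite ler_pdivrMr //; lra.
pose eps : R := eta / 16.
have eps0 : 0 < eps by rewrite /eps; lra.
(* [ln k >= B1] gives [ln (c * ln i) <= 2 * eps * ln i] for [i >= k], and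
   [ln k >= B2] gives [c * (2 p + 1) * ln k <= k]; both follow from
   [ln x <= s * x - 1 - ln s]. *)
pose B1 : R := (- 1 - ln (eps / c)) / eps.
pose s : R := (2 * c * p.*2.+1%:R)^-1.
have d0 : 0 < 2 * c * p.*2.+1%:R by rewrite !mulr_gt0 ?ltr0n.
have s0 : 0 < s by rewrite invr_gt0.
pose B2 : R := 2 * c * p.*2.+1%:R * (- 1 - ln s).
pose B := Num.max (Num.max c^-1 (24 / eta)) (Num.max (16 * c / eta) (Num.max B1 B2)).
have [k [k1 kn0 hk]] := exists_nat_large_ln R n0 B.
have lk0 := @ln_nat_gt0 R _ k1.
have k0 : 0 < k%:R :> R by rewrite ltr0n; lia.
move: hk; rewrite /B !ge_max => /andP[/andP[hk1 hk2] /and3P[hk3 hk4 hk5]].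
have lk_le : ln k%:R <= k%:R :> R by apply/ltW/ln_sublinear.
have hkY : c * p.*2.+1%:R * ln k%:R <= k%:R.
  have h := @ln_le_linear R s k%:R s0 k0.
  have hB2 : 2 * c * p.*2.+1%:R * (- 1 - ln s) <= k%:R by exact: le_trans lk_le.
  have : 2 * c * p.*2.+1%:R * ln k%:R <= 2 * c * p.*2.+1%:R * (s * k%:R + (-1 - ln s)).
    by rewrite ler_pM2l //; lra.
  by rewrite mulrDr mulrA divff ?lt0r_neq0 // mul1r; lra.
have k_gt0 : (0 < k)%N by exact: ltnW.
(* The four parameters are kept abstract behind the few identities needed. *)
have [m mE] : exists m, m = (k ^ p.+1)%N by eexists.
have [H HE'] : exists H, H = (k ^ p.+1.*2)%N by eexists.
have [n nE] : exists n, n = (k ^ p.*2.+1)%N by eexists.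
have [Y YE] : exists Y, Y = (k ^ (4 * p + 3))%N by eexists.
have km : (k <= m)%N by rewrite mE expnS leq_pmulr // expn_gt0 k_gt0.
have mn : (m <= n)%N.
  by rewrite mE nE; apply: leq_pexp2l => //; rewrite ltnS -addnn leq_addr.
have HY : (H <= Y)%N by rewrite HE' YE; apply: leq_pexp2l => //; clear; lia.
have kH : (k <= H)%N by rewrite HE' doubleS expnS leq_pmulr // expn_gt0 k_gt0.
have n_gt0 : (0 < n)%N by exact: leq_trans k_gt0 (leq_trans km mn).
have nH : n%:R / H%:R = k%:R^-1 :> R.
  have -> : H = (k * n)%N by rewrite HE' nE -expnS doubleS.
  by rewrite natrM invfM mulrCA divff ?mulr1 // pnatr_eq0 -lt0n.
have HE : H%:R = m%:R ^+ 2 :> R by rewrite -natrX HE' mE -expnM muln2.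
have YnE : Y = (n ^ 2 * k)%N.
  by rewrite YE nE -expnM -expnSr; congr expn; clear; lia.
have lnE : ln n%:R = p.*2.+1%:R * ln k%:R :> R.
  by rewrite nE natrX lnXn // mulr_natl.
have LLnm : ln (ln n%:R) - ln (ln m%:R) = ln (p.*2.+1%:R / p.+1%:R) :> R.
  by rewrite nE mE lnln_pow_sub.
have LLYH : ln (ln Y%:R) - ln (ln H%:R) = ln ((4 * p + 3)%:R / p.+1.*2%:R) :> R.
  by rewrite YE HE' lnln_pow_sub // addnC.
clear mE nE YE HE'.
have lnH : ln k%:R <= ln H%:R :> R by rewrite ler_ln_nat.
have lnm i : (m <= i)%N -> ln k%:R <= ln i%:R :> R.
  by move=> mi; rewrite ler_ln_nat // (leq_trans km).
(* Since [H = m ^ 2], the bound exceeds [H] as soon as [c * ln i >= 1]. *)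
have fH i : (m <= i)%N -> H%:R <= c * i%:R ^+ 2 * ln i%:R.
  move=> mi; have cl : 1 <= c * ln i%:R.
    rewrite mulrC -ler_pdivrMr // mul1r; exact: le_trans (lnm _ mi).
  have -> : c * i%:R ^+ 2 * ln i%:R = i%:R ^+ 2 * (c * ln i%:R) by ring.
  rewrite HE -[X in X <= _]mulr1 ler_pM //.
  by rewrite -!natrX ler_nat leq_exp2r.
have fY i : (m <= i)%N -> (i < n)%N -> (a i <= Y)%N.
  move=> mi i_n; rewrite -(ler_nat R); apply: le_trans (aub _ _) _.
    exact: leq_trans kn0 (leq_trans km mi).
  apply: (@le_trans _ _ (n%:R ^+ 2 * (c * ln n%:R))).
    have -> : c * i%:R ^+ 2 * ln i%:R = i%:R ^+ 2 * (c * ln i%:R) by ring.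
    rewrite ler_pM ?sqr_ge0 //.
    - by rewrite mulr_ge0 ?ltW //; apply: lt_le_trans (lnm _ mi).
    - by rewrite -!natrX ler_nat leq_exp2r // ltnW.
    - by rewrite ler_pM2l // ler_ln_nat ?(ltnW i_n) // (leq_trans _ mi) // (leq_trans k_gt0).
  by rewrite YnE natrM natrX ler_wpM2l ?sqr_ge0 // lnE mulrA.
pose b (i : 'I_(n - m)) : nat := a (m + i)%N.
have m0 : (0 < m)%N by exact: leq_trans km.
have injb : injective b.
  move=> i j; rewrite /b => e; apply: val_inj => /=.
  have := ainc (m + i)%N (m + j)%N (ltn_addr _ m0).
  have := ainc (m + j)%N (m + i)%N (ltn_addr _ m0).
  rewrite !ltn_add2l e ltnn.
  by case: ltngtP => // _ h1 h2; first [by have := h1 isT | by have := h2 isT].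
have pairs := @golomb_card_pairs g A _ b golA injb
  (fun i => aA _ (ltn_addr i m0)).
have := @window_log_inequality R g m (n - m) H (Y - H) c eps b c0 (ltW eps0).
rewrite !subnKC //.
have m1 : (1 < m)%N by exact: leq_trans km.
have H1 : (1 < H)%N by exact: leq_trans kH.
move=> /(_ m1 H1 injb pairs).
have hbY (i : 'I_(n - m)) : (b i <= Y)%N.
  by apply: fY; [exact: leq_addr | rewrite -ltn_subRL].
have hmax (i : 'I_(n - m)) :
    (maxn (b i) H)%:R <= c * (m + i)%:R ^+ 2 * ln (m + i)%:R.
  have [_|_] := leqP H (b i).
    by apply: aub; rewrite (leq_trans kn0) // (leq_trans km) // leq_addr.
  by apply: fH; exact: leq_addr.
have hcln (i : 'I_(n - m)) : ln (c * ln (m + i)%:R) <= 2 * eps * ln (m + i)%:R.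
  have lmi : ln k%:R <= ln (m + i)%:R :> R by apply: lnm; exact: leq_addr.
  have lmi0 : 0 < ln (m + i)%:R :> R by exact: lt_le_trans lmi.
  have := @ln_le_linear R (eps / c) (c * ln (m + i)%:R).
  rewrite divr_gt0 // mulr_gt0 // => /(_ isT isT).
  rewrite mulrA divfK ?lt0r_neq0 //.
  have : B1 <= ln (m + i)%:R by exact: le_trans lmi.
  rewrite /B1 ler_pdivrMr //; lra.
move=> /(_ hbY hmax hcln).
rewrite LLnm LLYH.
have q0 : 0 < p.*2.+1%:R :> R by rewrite ltr0n.
have lnY : ln ((4 * p + 3)%:R / p.+1.*2%:R) <= ln 2 :> R.
  rewrite ler_ln ?posrE ?divr_gt0 ?ltr0n ?addn3 //.
  by rewrite ler_pdivrMr ?ltr0n // -natrM ler_nat; clear; lia.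
have lnn : ln 2 - (p.*2.+1%:R)^-1 <= ln (p.*2.+1%:R / p.+1%:R) :> R.
  have -> : p.*2.+1%:R / p.+1%:R = 2 / (p.+1.*2%:R / p.*2.+1%:R) :> R.
    have : p.+1%:R != 0 :> R by rewrite pnatr_eq0.
    rewrite -[p.+1.*2]muln2 natrM; move: (lt0r_neq0 q0).
    by move: p.*2.+1%:R p.+1%:R => x y x0 y0; field; rewrite x0 y0.
  rewrite ln_div ?posrE ?divr_gt0 ?ltr0n //.
  rewrite lerD2l lerN2.
  apply: le_trans (@ln_le_subr1 R _ _) _; first by rewrite divr_gt0 ?ltr0n.
  have -> : p.+1.*2%:R = p.*2.+1%:R + 1 :> R by rewrite natr1 doubleS.
  by rewrite mulrDl divff ?lt0r_neq0 // mul1r addrC addKr.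
have hr : (n - m)%:R / H%:R <= k%:R^-1 :> R.
  by rewrite -nH ler_wpM2r ?invr_ge0 // ler_nat leq_subr.
have hck : 2 * c * k%:R^-1 <= eta / 8.
  rewrite ler_pdivrMr //.
  have : 16 * c / eta <= k%:R by exact: le_trans lk_le.
  by rewrite ler_pdivrMr //; lra.
have h3 : 3 / ln H%:R <= eta / 8.
  have lH0 : 0 < ln H%:R :> R by exact: lt_le_trans lnH.
  rewrite ler_pdivrMr //.
  have : 24 / eta <= ln H%:R by exact: le_trans lnH.
  by rewrite ler_pdivrMr //; lra.
move: lnY lnn; set X := ln (p.*2.+1%:R / p.+1%:R); set Z := ln (_ / p.+1.*2%:R).
move=> lnY lnn.
have ln21 := ln2_le1 R.
have X0 : 0 <= X by rewrite ln_ge0 // ler_pdivlMr ?ltr0n // mul1r ler_nat; clear; lia.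
have eps_inv : 2 * X - 2 * eps * X <= 2 / (1 + eps) * X.
  rewrite -mulrBl ler_wpM2r // ler_pdivlMr; [nra|lra].
have X1 : X <= 1.
  apply: le_trans ln21; rewrite ler_ln ?posrE ?divr_gt0 ?ltr0n //.
  by rewrite ler_pdivrMr ?ltr0n // -natrM ler_nat; clear; lia.
have hepsX : 2 * eps * X <= 2 * eps by rewrite -[leRHS]mulr1 ler_wpM2l //; lra.
have hrc : 2 * c * ((n - m)%:R / H%:R) <= 2 * c * k%:R^-1.
  by rewrite ler_wpM2l //; lra.
have etaE : eta = ln 2 - 2 * c * g%:R by [].
have epsE : eps = eta / 16 by [].
move: hp; rewrite [2 * c * (_ + _)]mulrDr.
move: (p.*2.+1%:R^-1 : R) lnn => ip lnn hp.
move: (2 / (1 + eps) * X) eps_inv => W eps_inv.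
clearbody eta eps X Z; lra.
Qed.

Theorem corollary2 (R : realType) (g : nat) (hg : (0 < g)%N)
    (A : set nat) (hA : infinite_set A) (hgolomb : golomb_ruler g A)
    (a : nat -> nat) (ha : increasing_enumeration A a) :
  ((ln 2 / (2 * g%:R) : R)%:E <=
   limn_esup (fun n : nat => ((a n)%:R / (n%:R ^+ 2 * ln n%:R) : R)%:E))%E.
Proof.
have [ainc aim] := ha.
have aA i : (0 < i)%N -> A (a i) by move=> i0; rewrite -aim; exists i.
have g0 : 0 < g%:R :> R by rewrite ltr0n.
set L : R := ln 2 / _.
have L0 : 0 < L by rewrite divr_gt0 ?ln_gt0 ?mulr_gt0 //; lra.
rewrite leNgt; apply/negP => /ereal_inf_lt[_ [V Vinf <-]] supV.
have [n0 _ n0V] := Vinf.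
have [c [c0 cL cub]] : exists c : R, [/\ 0 < c, c < L &
    forall n, (n0 <= n)%N -> (a n)%:R / (n%:R ^+ 2 * ln n%:R) <= c].
  have : forall n, (n0 <= n)%N -> (((a n)%:R / (n%:R ^+ 2 * ln n%:R) : R)%:E <=
      ereal_sup [set ((a x)%:R / (x%:R ^+ 2 * ln x%:R) : R)%:E | x in V])%E.
    by move=> n nn0; apply: ereal_sup_ubound; exists n => //; exact: n0V.
  case: (ereal_sup _) supV => [r|//|_].
  (* The maximum with [L / 2] makes the constant positive. *)
  - rewrite lte_fin => rL h; exists (Num.max r (L / 2)); split.
    + by rewrite lt_max; apply/orP; right; lra.
    + by rewrite gt_max rL; lra.
    + by move=> n /h; rewrite lee_fin le_max => ->.
  - by move=> /(_ n0 (leqnn _)); rewrite leeNy_eq.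
have : ln 2 <= 2 * c * g%:R.
  apply: (@golomb_growth_constant R g A a c (maxn 2 n0)) => // n nn0.
  have n1 : (1 < n)%N by lia.
  have d0 : 0 < n%:R ^+ 2 * ln n%:R :> R.
    by rewrite mulr_gt0 ?ln_nat_gt0 // exprn_gt0 // ltr0n; lia.
  by rewrite -mulrA -ler_pdivrMr //; apply: cub; lia.
move: cL; rewrite /L ltr_pdivlMr ?mulr_gt0 //; lra.
Qed.
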